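(* For every integer $n\ge 4$ there exist four weighted directed graphs $w_1,w_2,w_3,w_4:[n]^{(2)}\to\mathbb R$ such that $w_i([n])=0$ and $\|w_i\|_1=n(n-1)$ for every $i\in\{1,2,3,4\}$, and such that for all $1\le i<j\le 4$ $$\operatorname{disc}(w_i,w_j)=0.$$
   Context: Write $[n]=\{1,\dots,n\}$ and let $[n]^{(2)}=\{(x,y)\in[n]\times[n]:x\ne y\}$ be the set of ordered pairs of distinct vertices. A weighted directed graph on $[n]$ is a function $w:[n]^{(2)}\to\mathbb R$, with values written $w_{xy}$. For weighted directed graphs $w,u$ on $[n]$ put $\langle w,u\rangle=\sum_{x\ne y}w_{xy}u_{xy}$, $\|w\|_1=\sum_{x\ne y}|w_{xy}|$, $w([n])=\sum_{x\ne y}w_{xy}$ (sums over ordered pairs of distinct vertices), and $d(w)=w([n])/(n(n-1))$. For a permutation $\pi\in S_n$ the relabelling $w_\pi$ is $(w_\pi)_{xy}=w_{\pi^{-1}(x)\pi^{-1}(y)}$. Define $$\operatorname{disc}^+(w,u)=\max_{\pi\in S_n}\langle w_\pi,u\rangle-d(w)d(u)n(n-1),\qquad \operatorname{disc}^-(w,u)=d(w)d(u)n(n-1)-\min_{\pi\in S_n}\langle w_\pi,u\rangle,$$ and $\operatorname{disc}(w,u)=\max\{\operatorname{disc}^+(w,u),\operatorname{disc}^-(w,u)\}$. *)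

(* Defs.v *)
From mathcomp Require Import all_boot all_order all_fingroup all_algebra.
From mathcomp Require Import reals.

Set Implicit Arguments.
Unset Strict Implicit.
Unset Printing Implicit Defensive.

Import Order.TTheory GRing.Theory Num.Theory.

Local Open Scope ring_scope.

(* The vertex set {1, ..., n} is represented by 'I_n = {0, ..., n-1}. *)
Definition arc (n : nat) := {e : 'I_n * 'I_n | e.1 != e.2}.

Lemma arc_perm_subproof (n : nat) (s : 'S_n) (e : arc n) :
  (s (val e).1, s (val e).2).1 != (s (val e).1, s (val e).2).2.
Proof. by rewrite /= (inj_eq perm_inj) (valP e). Qed.

Definition arc_perm (n : nat) (s : 'S_n) (e : arc n) : arc n :=
  exist _ (s (val e).1, s (val e).2) (arc_perm_subproof s e).

Definition wdigraph (R : realType) (n : nat) := {ffun arc n -> R}.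

Section Discrepancy.
Variables (R : realType) (n : nat).
Implicit Types (w u : wdigraph R n) (s : 'S_n).

Definition weight_inner w u : R := \sum_(e : arc n) w e * u e.

Definition l1_norm w : R := \sum_(e : arc n) `|w e|.

Definition total_weight w : R := \sum_(e : arc n) w e.

Definition density w : R := total_weight w / (n%:R * (n%:R - 1)).

Definition relabel s w : wdigraph R n :=
  [ffun e => w (arc_perm s^-1%g e)].

(* A bigop over max (min) needs a default value; the value at the identity
   permutation is one of the terms, so it does not affect the extremum. *)
Definition max_inner w u : R :=
  \big[Num.max/weight_inner (relabel 1%g w) u]_(s : 'S_n) weight_inner (relabel s w) u.

Definition min_inner w u : R :=
  \big[Num.min/weight_inner (relabel 1%g w) u]_(s : 'S_n) weight_inner (relabel s w) u.

Definition disc_plus w u : R :=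
  max_inner w u - density w * density u * (n%:R * (n%:R - 1)).

Definition disc_minus w u : R :=
  density w * density u * (n%:R * (n%:R - 1)) - min_inner w u.

Definition disc w u : R := Num.max (disc_plus w u) (disc_minus w u).

End Discrepancy.

(* Main.v *)
Require Import Defs.
From mathcomp Require Import all_boot all_order all_fingroup all_algebra.
From mathcomp Require Import reals ring lra.

(** Under relabelling, the mean-zero weighted digraphs split into the symmetric
    and the antisymmetric ones, and each half splits further into the digraphs
    [a x ± a y] coming from a vertex weight [a] and those whose row and column
    sums all vanish. These four invariant subspaces are pairwise orthogonal and,
    for [n >= 4], nonzero; we normalise one element of each. *)

Set Implicit Arguments.
Unset Strict Implicit.
Unset Printing Implicit Defensive.

Import Order.TTheory GRing.Theory Num.Theory.

Local Open Scope ring_scope.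

Section Kernels.
Variables (R : realType) (n : nat).
Implicit Types (k l : 'I_n -> 'I_n -> R) (a b c : 'I_n -> R) (e : R).
Implicit Types (w u : wdigraph R n).

Definition kernel_digraph k : wdigraph R n := [ffun e => k (val e).1 (val e).2].

Definition scale_digraph e w : wdigraph R n := [ffun f => e * w f].

(** Taken with [e] equal to 1 or -1, for the symmetric or antisymmetric case. The factor
    [(x != y)%:R] clears the diagonal, so that sums over arcs become full double sums. *)
Definition vertex_kernel e a (x y : 'I_n) : R := (x != y)%:R * (a x + e * a y).

(** The symmetrised or antisymmetrised tensor product of [b] and [c]. Its diagonal vanishes when [b]
    and [c] have disjoint supports. *)
Definition tensor_kernel e b c (x y : 'I_n) : R := b x * c y + e * (c x * b y).

Lemma sum_arc k : (forall x, k x x = 0) ->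
  \sum_(e : Defs.arc n) k (val e).1 (val e).2 = \sum_x \sum_y k x y.
Proof.
move=> k0; rewrite pair_big /=.
rewrite (bigID (fun p : 'I_n * 'I_n => p.1 != p.2)) /=.
rewrite [X in _ + X]big1 ?addr0; last by move=> [x y] /= /negPn /eqP ->.
by rewrite -(big_sub [pred p : 'I_n * 'I_n | p.1 != p.2] (fun p => k p.1 p.2)).
Qed.

Lemma vertex_kernel_diag e a x : vertex_kernel e a x x = 0.
Proof. by rewrite /vertex_kernel eqxx mul0r. Qed.

Lemma relabel_kernel (s : 'S_n) k :
  relabel s (kernel_digraph k) =
  kernel_digraph (fun x y => k (s^-1%g x) (s^-1%g y)).
Proof. by apply/ffunP => e; rewrite !ffunE. Qed.

Lemma relabel_scale (s : 'S_n) e w :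
  relabel s (scale_digraph e w) = scale_digraph e (relabel s w).
Proof. by apply/ffunP => f; rewrite !ffunE. Qed.

Lemma weight_inner_scale e f w u :
  weight_inner (scale_digraph e w) (scale_digraph f u) =
  e * f * weight_inner w u.
Proof.
by rewrite /weight_inner mulr_sumr; apply: eq_bigr => g _; rewrite !ffunE mulrACA.
Qed.

Lemma total_weight_scale e w :
  total_weight (scale_digraph e w) = e * total_weight w.
Proof.
by rewrite /total_weight mulr_sumr; apply: eq_bigr => g _; rewrite !ffunE.
Qed.

Lemma l1_norm_scale e w : l1_norm (scale_digraph e w) = `|e| * l1_norm w.
Proof.
by rewrite /l1_norm mulr_sumr; apply: eq_bigr => g _; rewrite !ffunE normrM.
Qed.

Lemma l1_norm_gt0 w f : w f != 0 -> 0 < l1_norm w.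
Proof.
move=> wf; rewrite /l1_norm (bigD1 f) //= ltr_wpDr ?normr_gt0 //.
by apply: sumr_ge0.
Qed.

Lemma weight_inner_kernel k l : (forall x, l x x = 0) ->
  weight_inner (kernel_digraph k) (kernel_digraph l) =
  \sum_x \sum_y k x y * l x y.
Proof.
move=> l0; rewrite -sum_arc; last by move=> x; rewrite l0 mulr0.
by apply: eq_bigr => e _; rewrite !ffunE.
Qed.

(** The density product vanishes with the density of [w], and the maximum and minimum are taken over
    zeros only, default value included. *)
Lemma disc_orthogonal w u : total_weight w = 0 ->
  (forall s : 'S_n, weight_inner (relabel s w) u = 0) -> disc w u = 0.
Proof.
move=> w0 wu0; rewrite /disc /disc_plus /disc_minus /density w0 !mul0r.
have -> : max_inner w u = 0.
  rewrite /max_inner; elim/big_ind: _ => // x y -> ->; exact: maxxx.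
have -> : min_inner w u = 0.
  rewrite /min_inner; elim/big_ind: _ => // x y -> ->; exact: minxx.
by rewrite subrr maxxx.
Qed.

(** Exchanging [x] and [y] multiplies each term by [e * - e = -1], so the sum equals its own
    opposite. *)
Lemma sum_sym_anti k l e : (forall x y, k y x = e * k x y) ->
  (forall x y, l y x = - e * l x y) -> e * e = 1 ->
  \sum_x \sum_y k x y * l x y = 0.
Proof.
move=> ksym lsym e2.
set S := LHS; suff : S = - S by lra.
rewrite {1}/S exchange_big -sumrN /=; apply: eq_bigr => x _.
rewrite -sumrN; apply: eq_bigr => y _.
by rewrite ksym lsym mulrACA mulrN e2 mulN1r.
Qed.

(** The part [a x] is constant along rows and meets the row sums of [k]; the part [e * a y] is
    constant along columns and meets the column sums. *)
Lemma sum_vertex_kernel e a k : (forall x, k x x = 0) ->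
  (forall x, \sum_y k x y = 0) -> (forall y, \sum_x k x y = 0) ->
  \sum_x \sum_y vertex_kernel e a x y * k x y = 0.
Proof.
move=> k0 krow kcol.
transitivity (\sum_x \sum_y (a x * k x y + e * a y * k x y)).
  apply: eq_bigr => x _; apply: eq_bigr => y _; rewrite /vertex_kernel.
  by case: eqP => [->|_] /=; rewrite ?k0 ?mulr0 ?addr0 // mul1r mulrDl.
under eq_bigr do rewrite big_split /= -mulr_sumr krow mulr0 add0r.
by rewrite exchange_big big1 // => y _; rewrite -mulr_sumr kcol mulr0.
Qed.

Lemma sum_vertex_kernel_total e a : \sum_x a x = 0 ->
  \sum_x \sum_y vertex_kernel e a x y = 0.
Proof.
move=> a0.
have row x : \sum_y vertex_kernel e a x y = (n%:R - (1 + e)) * a x.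
  (* Complete the row with its missing diagonal term, then subtract it. *)
  transitivity (\sum_y (a x + e * a y) - (a x + e * a x)).
    rewrite (bigD1 x) //= [in RHS](bigD1 x) //= vertex_kernel_diag add0r.
    rewrite addrAC subrr add0r; apply: eq_bigr => y; rewrite eq_sym => xy.
    by rewrite /vertex_kernel xy mul1r.
  rewrite big_split /= -mulr_sumr a0 mulr0 addr0 sumr_const card_ord -mulr_natl.
  by ring.
by under eq_bigr do rewrite row; rewrite -mulr_sumr a0 mulr0.
Qed.

Lemma tensor_kernel_row e b c x : \sum_x b x = 0 -> \sum_x c x = 0 ->
  \sum_y tensor_kernel e b c x y = 0.
Proof.
move=> b0 c0; rewrite big_split /= -!mulr_sumr c0 b0.
by rewrite !mulr0 addr0.
Qed.

Lemma tensor_kernel_col e b c y : \sum_x b x = 0 -> \sum_x c x = 0 ->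
  \sum_x tensor_kernel e b c x y = 0.
Proof.
move=> b0 c0; rewrite big_split /= -mulr_suml b0 mul0r add0r -mulr_sumr.
by rewrite -mulr_suml c0 mul0r mulr0.
Qed.

Lemma tensor_kernel_diag e b c x : b x * c x = 0 -> tensor_kernel e b c x x = 0.
Proof. by rewrite /tensor_kernel [c x * _]mulrC => ->; rewrite mulr0 addr0. Qed.

Lemma vertex_kernel_perm e a (s : 'S_n) x y :
  vertex_kernel e a (s x) (s y) = vertex_kernel e (a \o s) x y.
Proof. by rewrite /vertex_kernel (inj_eq perm_inj). Qed.

Lemma vertex_kernel_sym e a x y : e * e = 1 ->
  vertex_kernel e a y x = e * vertex_kernel e a x y.
Proof.
by move=> e2; rewrite /vertex_kernel eq_sym; ring: e2.
Qed.

Lemma tensor_kernel_sym e b c x y : e * e = 1 ->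
  tensor_kernel e b c y x = e * tensor_kernel e b c x y.
Proof. by move=> e2; rewrite /tensor_kernel; ring: e2. Qed.

End Kernels.

Theorem theorem1p5 (R : realType) (n : nat) (hn : (4 <= n)%N) :
  exists w : 'I_4 -> wdigraph R n,
    (forall i : 'I_4,
        total_weight (w i) = 0 /\ l1_norm (w i) = n%:R * (n%:R - 1)) /\
    (forall i j : 'I_4, (i < j)%N -> disc (w i) (w j) = 0).
Proof.
(* Four distinct vertices, available because [n >= 4]. *)
pose p (i : 'I_4) : 'I_n := widen_ord hn i.
pose dirac (i : 'I_4) (x : 'I_n) : R := (x == p i)%:R.
have sum_dirac i : \sum_x dirac i x = 1.
  by rewrite /dirac (bigD1 (p i)) //= eqxx big1 ?addr0 // => x /negbTE ->.
(* Two vertex weights of sum zero with disjoint supports. *)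
pose b x := dirac 0 x - dirac 2 x; pose c x := dirac 1 x - dirac 3 x.
have b0 : \sum_x b x = 0 by rewrite sumrB !sum_dirac subrr.
have c0 : \sum_x c x = 0 by rewrite sumrB !sum_dirac subrr.
have bc0 x : b x * c x = 0.
  rewrite /b /c /dirac; case: (x =P p 0) => [->|_]; first by rewrite subrr mulr0.
  by case: (x =P p 2) => [->|_]; rewrite subrr ?mulr0 ?mul0r.
(* The parity of the index decides symmetric or antisymmetric; its comparison with 2 decides vertex
   or tensor kernel. *)
pose e (i : nat) : R := (-1) ^+ i.
have e2 i : e i * e i = 1 by rewrite -expr2 sqrr_sign.
pose k (i : 'I_4) := if (i < 2)%N then vertex_kernel (e i) b
                     else tensor_kernel (e i) b c.
have k_diag i x : k i x x = 0.
  by rewrite /k; case: ifP => _; [apply: vertex_kernel_diag | apply: tensor_kernel_diag].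
have k_sym i x y : k i y x = e i * k i x y.
  by rewrite /k; case: ifP => _; [apply: vertex_kernel_sym | apply: tensor_kernel_sym].
have k_total i : total_weight (kernel_digraph (k i)) = 0.
  transitivity (\sum_x \sum_y k i x y).
    by rewrite -sum_arc //; apply: eq_bigr => f _; rewrite ffunE.
  rewrite /k; case: ifP => _; first exact: sum_vertex_kernel_total.
  by rewrite big1 // => x _; apply: tensor_kernel_row.
(* All four kernels take the value 1 on this arc, so none of their norms is zero. *)
have p01 : (p 0, p 1).1 != (p 0, p 1).2 by [].
have k_norm i : 0 < l1_norm (kernel_digraph (k i)).
  apply: (@l1_norm_gt0 _ _ _ (exist _ (p 0, p 1) p01)); rewrite ffunE /=.
  have [bp0 bp1 cp0 cp1] : [/\ b (p 0) = 1, b (p 1) = 0, c (p 0) = 0 & c (p 1) = 1].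
    by rewrite /b /c /dirac /= !subr0.
  rewrite /k; case: ifP => _; rewrite /vertex_kernel /tensor_kernel.
    by rewrite bp0 bp1 mulr0 addr0 mulr1 oner_eq0.
  by rewrite bp0 bp1 cp0 cp1 !mulr0 addr0 mulr1 oner_eq0.
pose w i := scale_digraph (n%:R * (n%:R - 1) / l1_norm (kernel_digraph (k i)))
                          (kernel_digraph (k i)).
have w_total i : total_weight (w i) = 0.
  by rewrite total_weight_scale k_total mulr0.
exists w; split=> [i|i j lt_ij]; first split=> //.
  rewrite l1_norm_scale ger0_norm ?divfK ?gt_eqF //.
  apply: divr_ge0; last exact: ltW.
  by rewrite mulr_ge0 ?ler0n // subr_ge0 ler1n (leq_trans _ hn).
apply: disc_orthogonal => // s.
rewrite relabel_scale relabel_kernel weight_inner_scale weight_inner_kernel //.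
apply/eqP; rewrite mulf_eq0; apply/orP; right; apply/eqP.
have [odd_ij|odd_ij] := eqVneq (odd i) (odd j).
  (* With [i < j], equal parity leaves only the pairs (0, 2) and (1, 3): a vertex kernel against a
     tensor kernel. *)
  have [i2 j2] : (i < 2)%N = true /\ (j < 2)%N = false.
    by case: i j lt_ij odd_ij => [[|[|[|[|i]]]] ?] [[|[|[|[|j]]]] ?].
  rewrite /k i2 j2.
  (* A relabelled vertex kernel is the vertex kernel of the permuted weight. *)
  under eq_bigr do under eq_bigr do rewrite vertex_kernel_perm.
  apply: sum_vertex_kernel.
  - move=> x; exact: tensor_kernel_diag.
  - move=> x; exact: tensor_kernel_row.
  - move=> y; exact: tensor_kernel_col.
(* Opposite parities: one kernel is symmetric, the other antisymmetric, and relabelling preserves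
   this. *)
apply: (@sum_sym_anti _ _ _ _ (e i)) => // x y.
rewrite k_sym; congr (_ * _); rewrite /e -(signr_odd _ i) -(signr_odd _ j).
by case: (odd i) (odd j) odd_ij => [] [] //=; rewrite ?expr1 ?expr0 ?opprK.
Qed.
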